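(* Let $m<n$ and $1\le k<n$ be positive integers, let $A\in\mathbb{R}^{m\times n}$, and let $x\in\mathbb{R}^n$, $y,\nu\in\mathbb{R}^m$ satisfy $y=Ax+\nu$. Let $s(k)=1$ if $k$ is odd and $s(k)=0$ if $k$ is even. Let $\gamma^*$ ($\approx 0.2274$) be the unique root of $5\gamma^3+5\gamma^2+3\gamma-1=0$ in the interval $(0,1)$. Assume that the restricted isometry constant of $A$ satisfies $\delta_{k+s(k)}<\gamma^*$, put $$\eta:=\sqrt{\frac{1+\delta_k}{1-2\delta_k-\delta_{k+s(k)}}},$$ and assume that the parameters $\alpha>0$, $\beta$ of the algorithms satisfy $$0\leq\beta<\frac{1+1/\eta}{1+\sqrt{5}\,\delta_{k+s(k)}}-1,\qquad \frac{1+2\beta-1/\eta}{1-\sqrt{5}\,\delta_{k+s(k)}}<\alpha<\frac{1+1/\eta}{1+\sqrt{5}\,\delta_{k+s(k)}}.$$ Let $S:=\mathcal{L}_k(x)$, $\overline S:=\{1,\dots,n\}\setminus S$, $\nu':=\nu+Ax_{\overline{S}}$, and $$b:=\eta\left(|1+\beta-\alpha|+\sqrt{5}\,\alpha\,\delta_{k+s(k)}\right),\qquad \theta:=\frac{b+\sqrt{b^2+4\eta\beta}}{2}.$$ Then $\theta<1$, and every sequence $\{x^p\}$ generated by HBOT or by HBOTP with input $(A,y,k)$ and $k$-sparse initial points $x^0,x^1$ satisfies, for all $p\ge 1$, $$\|x_S-x^p\|_2\leq C_1\theta^{p-1}+C_2\|\nu'\|_2,$$ where $$C_1=\|x_S-x^1\|_2+(\theta-b)\|x_S-x^0\|_2,\qquad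 C_2=\frac{2+(1+\delta_k)\alpha}{(1-\theta)\sqrt{1-2\delta_k-\delta_{k+s(k)}}}.$$
   Context: Notation. A vector is $k$-sparse if it has at most $k$ nonzero entries. For a vector $z\in\mathbb{R}^n$ and $\Omega\subseteq\{1,\dots,n\}$, $z_\Omega\in\mathbb{R}^n$ is the vector that agrees with $z$ on $\Omega$ and is zero off $\Omega$; $\mathrm{supp}(z)=\{i: z_i\ne 0\}$; $\mathcal{L}_k(z)$ is the index set of the $k$ largest entries of $z$ in absolute value (ties broken in some fixed way). $u\circ v$ is the entrywise (Hadamard) product; $\mathbf{e}$ is the all-ones vector. Restricted isometry constant (RIC). For $A\in\mathbb{R}^{m\times n}$ with $m<n$, $\delta_t$ is the smallest number $\delta\ge 0$ such that $(1-\delta)\|u\|_2^2\le\|Au\|_2^2\le(1+\delta)\|u\|_2^2$ for all $t$-sparse $u\in\mathbb{R}^n$. Algorithms HBOT and HBOTP. Input: $(A,y,k)$, initial points $x^0,x^1\in\mathbb{R}^n$, parameters $\alpha>0$, $\beta\ge 0$. For $p=1,2,\dots$: (S1) $u^p=x^p-\alpha A^T(Ax^p-y)+\beta(x^p-x^{p-1})$. (S2) $w^*$ is a minimizer of $\|y-A(u^p\circ w)\|_2^2$ over all $w\in\{0,1\}^n$ with $\mathbf{e}^Tw=k$. (S3) For HBOT: $x^{p+1}=u^p\circ w^*$. For HBOTP: let $S^{p+1}=\mathrm{supp}(u^p\circ w^* )$ and let $x^{p+1}$ be a minimizer of $\|y-Ax\|_2^2$ over all $x\in\mathbb{R}^n$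 with $\mathrm{supp}(x)\subseteq S^{p+1}$. *)

(* Defs.v *)
From mathcomp Require Export all_boot all_order all_algebra.
From mathcomp Require Export boolp classical_sets reals.

Set Implicit Arguments.
Unset Strict Implicit.
Unset Printing Implicit Defensive.
Import Order.TTheory GRing.Theory Num.Theory.
Local Open Scope ring_scope.

(* The Euclidean norm; the norm the library puts on matrices is the sup norm. *)
Definition norm2 (R : rcfType) (n : nat) (u : 'cV[R]_n) : R :=
  Num.sqrt (\sum_(i < n) u i 0 ^+ 2).

Definition supp (R : realType) (n : nat) (u : 'cV[R]_n) : {set 'I_n} :=
  [set i | u i 0 != 0]%SET.

Definition sparse (R : realType) (n k : nat) (u : 'cV[R]_n) : Prop :=
  (#|supp u| <= k)%N.

Definition restrict (R : realType) (n : nat) (O : {set 'I_n}) (z : 'cV[R]_n) :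
  'cV[R]_n := \col_i (if i \in O then z i 0 else 0).

(* S is a possible value of L_k(z).  Every way of breaking ties yields such an
   S, and every such S is obtained from some way of breaking ties. *)
Definition largest (R : realType) (n k : nat) (z : 'cV[R]_n)
    (S : {set 'I_n}) : Prop :=
  #|S| = k /\ forall i j, i \in S -> j \notin S -> `|z j 0| <= `|z i 0|.

Definition hadamard (R : realType) (n : nat) (u v : 'cV[R]_n) : 'cV[R]_n :=
  map2_mx *%R u v.

Definition rip_bound (R : realType) (m n : nat) (A : 'M[R]_(m, n)) (t : nat)
    (d : R) : Prop :=
  0 <= d /\
  forall u : 'cV[R]_n, sparse t u ->
    (1 - d) * norm2 u ^+ 2 <= norm2 (A *m u) ^+ 2 /\
    norm2 (A *m u) ^+ 2 <= (1 + d) * norm2 u ^+ 2.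

(* The infimum is a minimum: see [ricP] and [ric_le]. *)
Definition ric (R : realType) (m n : nat) (A : 'M[R]_(m, n)) (t : nat) : R :=
  inf [set d | rip_bound A t d]%classic.

Definition minimizer (R : realType) (T : Type) (C : set T) (f : T -> R)
    (x : T) : Prop :=
  C x /\ forall z, C z -> f x <= f z.

Definition hb_point (R : realType) (m n : nat) (A : 'M[R]_(m, n))
    (y : 'cV[R]_m) (alpha beta : R) (xprev xcur : 'cV[R]_n) : 'cV[R]_n :=
  xcur - alpha *: (A^T *m (A *m xcur - y)) + beta *: (xcur - xprev).

Definition binary_weights (R : realType) (n k : nat) : set 'cV[R]_n :=
  [set w | (forall i, w i 0 = 0 \/ w i 0 = 1) /\
           \sum_(i < n) w i 0 = k%:R]%classic.

Definition optimal_weights (R : realType) (m n : nat) (A : 'M[R]_(m, n))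
    (y : 'cV[R]_m) (k : nat) (u w : 'cV[R]_n) : Prop :=
  minimizer (@binary_weights R n k)
    (fun w => norm2 (y - A *m hadamard u w) ^+ 2) w.

Definition HBOT (R : realType) (m n : nat) (A : 'M[R]_(m, n)) (y : 'cV[R]_m)
    (k : nat) (alpha beta : R) (X : nat -> 'cV[R]_n) : Prop :=
  forall p, (1 <= p)%N ->
    let u := hb_point A y alpha beta (X p.-1) (X p) in
    exists w, optimal_weights A y k u w /\ X p.+1 = hadamard u w.

Definition HBOTP (R : realType) (m n : nat) (A : 'M[R]_(m, n)) (y : 'cV[R]_m)
    (k : nat) (alpha beta : R) (X : nat -> 'cV[R]_n) : Prop :=
  forall p, (1 <= p)%N ->
    let u := hb_point A y alpha beta (X p.-1) (X p) in
    exists w, optimal_weights A y k u w /\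
      minimizer [set z | supp z \subset supp (hadamard u w)]%classic
        (fun z => norm2 (y - A *m z) ^+ 2) (X p.+1).

Section RicAttained.
Variables (R : realType) (m n : nat) (A : 'M[R]_(m, n)) (t : nat).

Lemma norm2_sqr p (u : 'cV[R]_p) : norm2 u ^+ 2 = \sum_(i < p) u i 0 ^+ 2.
Proof. by rewrite sqr_sqrtr // sumr_ge0 // => i _; rewrite sqr_ge0. Qed.

Lemma norm2_ge_coord p (u : 'cV[R]_p) i : `|u i 0| <= norm2 u.
Proof.
rewrite -sqrtr_sqr ler_wsqrtr // (bigD1 i) //= lerDl.
by rewrite sumr_ge0 // => j _; rewrite sqr_ge0.
Qed.

Lemma rip_bound_exists : exists d, rip_bound A t d.
Proof.
pose M := \sum_i (\sum_j `|A i j|) ^+ 2.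
have M0 : 0 <= M by rewrite sumr_ge0 // => i _; rewrite sqr_ge0.
exists (1 + M); split=> [|u _]; first by rewrite addr_ge0.
have N0 : 0 <= norm2 u ^+ 2 by rewrite sqr_ge0.
have QM : norm2 (A *m u) ^+ 2 <= M * norm2 u ^+ 2.
  rewrite norm2_sqr mulr_suml; apply: ler_sum => i _.
  rewrite -exprMn -[leLHS]real_normK ?num_real //.
  have h : `|(A *m u) i 0| <= (\sum_j `|A i j|) * norm2 u.
    rewrite mxE mulr_suml; apply: le_trans (ler_norm_sum _ _ _) _.
    by apply: ler_sum => j _; rewrite normrM ler_wpM2l // norm2_ge_coord.
  by rewrite lerXn2r // nnegrE // (le_trans _ h).
split.
  apply: le_trans (sqr_ge0 _).
  by rewrite opprD addrA subrr add0r mulNr oppr_le0 mulr_ge0.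
apply: le_trans QM _; rewrite ler_wpM2r //.
by rewrite addrA lerDr addr_ge0.
Qed.

Lemma ric_le d : rip_bound A t d -> ric A t <= d.
Proof.
move=> hd; apply: ge_inf => //.
by exists 0 => e [].
Qed.

Lemma ricP : rip_bound A t (ric A t).
Proof.
have [d0 hd0] := rip_bound_exists.
have ne : ([set d | rip_bound A t d] !=set0)%classic by exists d0.
have le_ric c : (forall d, rip_bound A t d -> c <= d) -> c <= ric A t.
  by move=> h; apply: lb_le_inf.
split; first by apply: le_ric => d [].
move=> u su; have [N0|N0] := eqVneq (norm2 u ^+ 2) 0.
  by have [_ /(_ u su)] := hd0; rewrite N0 !mulr0.
have Np : 0 < norm2 u ^+ 2 by rewrite lt_def N0 sqr_ge0.
split.
- rewrite mulrBl mul1r lerBlDr -lerBlDl -ler_pdivrMr //; apply: le_ric => d.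
  by case=> _ /(_ u su)[+ _]; rewrite mulrBl mul1r lerBlDr -lerBlDl -ler_pdivrMr.
- rewrite mulrDl mul1r -lerBlDl -ler_pdivrMr //; apply: le_ric => d.
  by case=> _ /(_ u su)[_]; rewrite mulrDl mul1r -lerBlDl -ler_pdivrMr.
Qed.

End RicAttained.

(* Main.v *)
(* The residual of the optimally thresholded point is at most that of u_S, and a
   2k-sparse z satisfies (1 - 2 delta_k - delta_{k+s}) |z|^2 <= |Az|^2; hence
   |x_S - x^{p+1}| <= eta |(x_S - u^p)_S| up to noise.  Expanding the heavy-ball
   step, (x_S - u^p)_S involves ((I - A^T A)(x_S - x^p))_S, whose norm is at most
   sqrt 5 delta_{k+s} |x_S - x^p|: the part of the error on S contributes
   delta_{k+s} and the part off S contributes 2 delta_{k+s}, the latter by cutting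
   k-sparse vectors into halves, so that any two pieces together span at most
   k + s coordinates.  The resulting two-step linear recurrence has the
   characteristic polynomial t^2 - b t - eta beta, of which theta is the positive
   root; the conditions on alpha say exactly that b + eta beta < 1.  The root
   gamma only matters through gamma < 1/3. *)
From mathcomp Require Import ring lra zify.
Require Import Defs.
Import Order.TTheory GRing.Theory Num.Theory.
Local Open Scope ring_scope.
Set Implicit Arguments.
Unset Strict Implicit.
Unset Printing Implicit Defensive.

(** * Euclidean inner product and norm *)

Section Euclidean.
Variable R : realType.
Implicit Types (c : R).

Definition dotc n (u v : 'cV[R]_n) : R := (u^T *m v) 0 0.

Lemma dotcE n (u v : 'cV[R]_n) : dotc u v = \sum_i u i 0 * v i 0.
Proof. by rewrite /dotc mxE; apply: eq_bigr => i _; rewrite mxE. Qed.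

Lemma dotcC n (u v : 'cV[R]_n) : dotc u v = dotc v u.
Proof. by rewrite !dotcE; apply: eq_bigr => i _; rewrite mulrC. Qed.

Lemma dotcDr n (u v w : 'cV[R]_n) : dotc u (v + w) = dotc u v + dotc u w.
Proof. by rewrite /dotc mulmxDr mxE. Qed.

Lemma dotcZr n c (u v : 'cV[R]_n) : dotc u (c *: v) = c * dotc u v.
Proof. by rewrite /dotc -scalemxAr mxE. Qed.

Lemma dotcDl n (u v w : 'cV[R]_n) : dotc (v + w) u = dotc v u + dotc w u.
Proof. by rewrite dotcC dotcDr !(dotcC u). Qed.

Lemma dotcZl n c (u v : 'cV[R]_n) : dotc (c *: v) u = c * dotc v u.
Proof. by rewrite dotcC dotcZr (dotcC u). Qed.

Lemma dotcBr n (u v w : 'cV[R]_n) : dotc u (v - w) = dotc u v - dotc u w.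
Proof. by rewrite -scaleN1r dotcDr dotcZr mulN1r. Qed.

Lemma dotcBl n (u v w : 'cV[R]_n) : dotc (v - w) u = dotc v u - dotc w u.
Proof. by rewrite dotcC dotcBr !(dotcC u). Qed.

Lemma dotc_mul m n (A : 'M[R]_(m, n)) (u : 'cV[R]_n) (v : 'cV[R]_m) :
  dotc (A *m u) v = dotc u (A^T *m v).
Proof. by rewrite /dotc trmx_mul mulmxA. Qed.

Lemma norm2_dotc n (u : 'cV[R]_n) : norm2 u ^+ 2 = dotc u u.
Proof. by rewrite norm2_sqr dotcE. Qed.

Lemma norm2_ge0 n (u : 'cV[R]_n) : 0 <= norm2 u.
Proof. exact: sqrtr_ge0. Qed.

Lemma norm2_eq0 n (u : 'cV[R]_n) : norm2 u = 0 -> u = 0.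
Proof.
move=> u0; apply/matrixP => i j; rewrite ord1 mxE; apply/eqP.
by rewrite -normr_le0 -u0 norm2_ge_coord.
Qed.

Lemma norm2Z n c (u : 'cV[R]_n) : norm2 (c *: u) = `|c| * norm2 u.
Proof.
apply/eqP; rewrite -(@eqrXn2 _ 2) ?mulr_ge0 ?norm2_ge0 //.
by rewrite exprMn !norm2_dotc dotcZl dotcZr mulrA -expr2 real_normK ?num_real.
Qed.

(* Apply the hypothesis to [norm2 v *: u] and [norm2 u *: v]. *)
Lemma bilinear_bound n (F : 'cV[R]_n -> 'cV[R]_n -> R) c (u v : 'cV[R]_n) :
  (forall a b, F (a *: u) (b *: v) = a * b * F u v) ->
  (forall a b, 2 * F (a *: u) (b *: v)
     <= c * (norm2 (a *: u) ^+ 2 + norm2 (b *: v) ^+ 2)) ->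
  F u v <= c * norm2 u * norm2 v.
Proof.
move=> hF hle.
have [/eqP u0|u0] := boolP (norm2 u == 0).
  have := hF 0 1; rewrite u0 (norm2_eq0 u0) scaler0 scale1r !mul0r => ->.
  by rewrite mulr0 mul0r.
have [/eqP v0|v0] := boolP (norm2 v == 0).
  have := hF 1 0; rewrite v0 (norm2_eq0 v0) scaler0 scale1r mulr0 mul0r => ->.
  by rewrite mulr0.
have up : 0 < norm2 u by rewrite lt_def u0 norm2_ge0.
have vp : 0 < norm2 v by rewrite lt_def v0 norm2_ge0.
have := hle (norm2 v) (norm2 u); rewrite hF !norm2Z !ger0_norm ?norm2_ge0 //.
have -> : c * ((norm2 v * norm2 u) ^+ 2 + (norm2 u * norm2 v) ^+ 2) =
   (2 * (norm2 v * norm2 u)) * (c * norm2 u * norm2 v) by ring.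
by rewrite mulrA ler_pM2l // !mulr_gt0.
Qed.

Lemma dotc_le n (u v : 'cV[R]_n) : dotc u v <= norm2 u * norm2 v.
Proof.
rewrite -[norm2 u]mul1r; apply: (bilinear_bound (F := @dotc n)) => a b.
  by rewrite dotcZl dotcZr mulrA.
set p := a *: u; set q := b *: v.
have := sqr_ge0 (norm2 (p - q)).
rewrite !norm2_dotc dotcBr !dotcBl (dotcC q p); lra.
Qed.

Lemma norm2D n (u v : 'cV[R]_n) : norm2 (u + v) <= norm2 u + norm2 v.
Proof.
rewrite -(@ler_pXn2r _ 2) ?nnegrE ?addr_ge0 ?norm2_ge0 //.
rewrite sqrrD !norm2_dotc dotcDl !dotcDr (dotcC v u).
have := dotc_le u v; lra.
Qed.

(** Used for duality: a restricted vector paired with itself is bounded through a bilinear estimate,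
    and one factor of its norm then cancels. *)
Lemma norm2_le_dot n (u : 'cV[R]_n) c :
  norm2 u ^+ 2 <= c * norm2 u -> 0 <= c -> norm2 u <= c.
Proof.
move=> h c0; have [/eqP ->//|u0] := boolP (norm2 u == 0).
have up : 0 < norm2 u by rewrite lt_def u0 norm2_ge0.
by move: h; rewrite expr2 ler_pM2r.
Qed.

End Euclidean.

(** * Coordinate restrictions and supports *)

Section Restriction.
Variables (R : realType) (n : nat).
Implicit Types (O : {set 'I_n}) (u v : 'cV[R]_n).

Lemma restrict_split O u : u = restrict O u + restrict (~: O) u.
Proof.
apply/matrixP => i j; rewrite ord1 !mxE finset.in_setC.
by case: (i \in O); rewrite ?addr0 ?add0r.
Qed.

Lemma dotc_restrict O u v : dotc (restrict O u) v = dotc (restrict O u) (restrict O v).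
Proof.
rewrite !dotcE; apply: eq_bigr => i _; rewrite !mxE.
by case: (i \in O); rewrite ?mul0r.
Qed.

Lemma restrictD O u v : restrict O (u + v) = restrict O u + restrict O v.
Proof.
by apply/matrixP => i j; rewrite !mxE; case: (i \in O); rewrite ?addr0.
Qed.

Lemma restrictZ O c u : restrict O (c *: u) = c *: restrict O u.
Proof.
by apply/matrixP => i j; rewrite !mxE; case: (i \in O); rewrite ?mulr0.
Qed.

Lemma restrictB O u v : restrict O (u - v) = restrict O u - restrict O v.
Proof. by rewrite -[- v]scaleN1r restrictD restrictZ scaleN1r. Qed.

Lemma norm2_restrict_split O u :
  norm2 u ^+ 2 = norm2 (restrict O u) ^+ 2 + norm2 (restrict (~: O) u) ^+ 2.
Proof.
rewrite !norm2_sqr -big_split; apply: eq_bigr => i _ /=; rewrite !mxE finset.in_setC.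
by case: (i \in O); rewrite /= expr0n ?addr0 ?add0r.
Qed.

Lemma norm2_restrict_le O u : norm2 (restrict O u) <= norm2 u.
Proof.
rewrite -(@ler_pXn2r _ 2) ?nnegrE ?norm2_ge0 // (norm2_restrict_split O u).
by rewrite lerDl sqr_ge0.
Qed.

Lemma supp_restrict O u : supp (restrict O u) = O :&: supp u.
Proof.
apply/setP => i; rewrite !inE mxE.
by case: (i \in O) => //=; rewrite eqxx.
Qed.

Lemma suppD u v : supp (u + v) \subset supp u :|: supp v.
Proof.
apply/fintype.subsetP => i; rewrite !inE mxE -negb_and; apply: contra.
by case/andP => /eqP -> /eqP ->; rewrite addr0.
Qed.

Lemma suppZ c u : supp (c *: u) \subset supp u.
Proof.
apply/fintype.subsetP => i; rewrite !inE mxE; apply: contra => /eqP ->.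
by rewrite mulr0.
Qed.

(** Cut the enumerated support after [s] indices; a shorter support goes entirely into the first
    piece. This supplies the halves of sparse vectors. *)
Lemma sparse_split (s t : nat) u : sparse (s + t) u ->
  exists O, sparse s (restrict O u) /\ sparse t (restrict (~: O) u).
Proof.
move=> su; pose O : {set 'I_n} := [set i | i \in take s (enum (supp u))]%SET.
have Oe : #|O| = minn s #|supp u|.
  rewrite cardsE (card_uniqP _) ?take_uniq ?enum_uniq //.
  by rewrite size_take_min cardE.
have OS : O \subset supp u.
  by apply/fintype.subsetP => i; rewrite inE => /mem_take; rewrite mem_enum.
exists O; rewrite /sparse !supp_restrict; split.
  by rewrite (finset.setIidPl OS) Oe geq_minl.
rewrite finset.setIC -finset.setDE finset.cardsD (finset.setIidPr OS) Oe.
move: su; rewrite /sparse; case: (leqP s #|supp u|) => h.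
  by rewrite leq_subLR.
by rewrite subnn.
Qed.

End Restriction.

(** * Consequences of the restricted isometry property *)

Section Isometry.
Variables (R : realType) (m n : nat) (A : 'M[R]_(m, n)).
Implicit Types (u v e z : 'cV[R]_n).

(** The bilinear form of [I - A^T A]. The isometry condition bounds its diagonal on sparse vectors
    from both sides by [d] times the squared norm. *)
Definition defect u v : R := dotc u v - dotc (A *m u) (A *m v).

Lemma defectC u v : defect u v = defect v u.
Proof. by rewrite /defect !(dotcC u) (dotcC (A *m u)). Qed.

Lemma defectDr u v e : defect u (v + e) = defect u v + defect u e.
Proof. by rewrite /defect mulmxDr !dotcDr; ring. Qed.

Lemma defectDl u v e : defect (v + e) u = defect v u + defect e u.
Proof. by rewrite defectC defectDr !(defectC u). Qed.

Lemma defectZ a b u v : defect (a *: u) (b *: v) = a * b * defect u v.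
Proof. by rewrite /defect -!scalemxAr !dotcZl !dotcZr; ring. Qed.

Lemma defectBr u v e : defect u (v - e) = defect u v - defect u e.
Proof. by rewrite /defect mulmxBr !dotcBr; ring. Qed.

Lemma defectBl u v e : defect (v - e) u = defect v u - defect e u.
Proof. by rewrite defectC defectBr !(defectC u). Qed.

Section Bound.
Variables (t : nat) (d : R).
Hypothesis dP : rip_bound A t d.

Lemma defect_sqr_bound u : sparse t u ->
  defect u u <= d * norm2 u ^+ 2 /\ - defect u u <= d * norm2 u ^+ 2.
Proof.
move=> /(proj2 dP u); rewrite /defect !norm2_dotc; lra.
Qed.

(** Polarization writes four times [defect u v] as the difference of the diagonal values at [u + v]
    and [u - v]; the parallelogram law adds up their bounds. Supports may overlap. *)
Lemma defect_bound2 u v : (#|supp u :|: supp v| <= t)%N ->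
  2 * defect u v <= d * (norm2 u ^+ 2 + norm2 v ^+ 2).
Proof.
move=> uv.
have sD : sparse t (u + v).
  exact: leq_trans (subset_leq_card (suppD u v)) uv.
have sB : sparse t (u - v).
  apply: leq_trans uv; apply/subset_leq_card/(fintype.subset_trans (suppD _ _)).
  by rewrite finset.setUS // -scaleN1r suppZ.
have [hD _] := defect_sqr_bound sD; have [_ hB] := defect_sqr_bound sB.
move: hD hB; rewrite !norm2_dotc !(defectBl, defectBr, defectDl, defectDr).
rewrite !(dotcBl, dotcBr, dotcDl, dotcDr) (defectC v u) (dotcC v u); lra.
Qed.

Lemma defect_bound2_sparse s r u v :
  sparse s u -> sparse r v -> (s + r <= t)%N ->
  2 * defect u v <= d * (norm2 u ^+ 2 + norm2 v ^+ 2).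
Proof.
move=> su rv srt; apply: defect_bound2.
apply: leq_trans srt; apply: leq_trans (leq_add su rv).
by rewrite finset.cardsU leq_subr.
Qed.

(** Scaling does not enlarge supports, so [bilinear_bound] turns the sum of squares into a product
    of norms. *)
Lemma defect_bound u v : (#|supp u :|: supp v| <= t)%N ->
  defect u v <= d * norm2 u * norm2 v.
Proof.
move=> uv; apply: (bilinear_bound (F := defect)) => a b; first exact: defectZ.
apply/defect_bound2/(leq_trans _ uv)/subset_leq_card.
by rewrite finset.setUSS ?suppZ.
Qed.

(** With both vectors halved, each of the four pairs of pieces spans at most [t] coordinates. Every
    piece occurs in two pairs, whence the factor 2. *)
Lemma defect_bound_cross k u v : (uphalf k + uphalf k <= t)%N ->
  sparse k u -> sparse k v -> defect u v <= 2 * d * norm2 u * norm2 v.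
Proof.
move=> kt su sv; apply: (bilinear_bound (F := defect)) => a b; first exact: defectZ.
have {}su : sparse (uphalf k + k./2) (a *: u).
  have <- : k = (uphalf k + k./2)%N by lia.
  exact: leq_trans (subset_leq_card (suppZ a u)) su.
have {}sv : sparse (uphalf k + k./2) (b *: v).
  have <- : k = (uphalf k + k./2)%N by lia.
  exact: leq_trans (subset_leq_card (suppZ b v)) sv.
have [O [u1 u2]] := sparse_split su; have [P [v1 v2]] := sparse_split sv.
rewrite (norm2_restrict_split O (a *: u)) (norm2_restrict_split P (b *: v)).
rewrite {1}(restrict_split O (a *: u)) {1}(restrict_split P (b *: v)).
rewrite !(defectDl, defectDr).
have h11 := defect_bound2_sparse u1 v1 kt.
have h12 := defect_bound2_sparse u1 v2 ltac:(lia).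
have h21 := defect_bound2_sparse u2 v1 ltac:(lia).
have h22 := defect_bound2_sparse u2 v2 ltac:(lia).
lra.
Qed.

End Bound.

Lemma rip_bound_mono s t d : (s <= t)%N -> rip_bound A t d -> rip_bound A s d.
Proof. by move=> st [d0 h]; split=> // u su; apply/h/(leq_trans su). Qed.

(* Each half of z is cut into pieces of sizes uphalf k and k./2.  A cross pair
   large-small spans k coordinates and costs d; large-large and small-small
   cost d', on disjoint parts of z. *)
Lemma defect_bound_double k t d d' z :
  (uphalf k + uphalf k <= t)%N -> rip_bound A k d -> rip_bound A t d' ->
  sparse (k + k) z -> defect z z <= (2 * d + d') * norm2 z ^+ 2.
Proof.
move=> kt hd hd' /sparse_split[Q [sa sb]].
rewrite (norm2_restrict_split Q) {1 2}(restrict_split Q z).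
set a := restrict Q z in sa *; set b := restrict _ z in sb *.
have [ha _] := defect_sqr_bound hd sa; have [hb _] := defect_sqr_bound hd sb.
rewrite defectDl !defectDr (defectC b a).
have kE : k = (uphalf k + k./2)%N by lia.
have {}sa : sparse (uphalf k + k./2) a by rewrite -kE.
have {}sb : sparse (uphalf k + k./2) b by rewrite -kE.
have [O [a1 a2]] := sparse_split sa; have [P [b1 b2]] := sparse_split sb.
have h11 := defect_bound2_sparse hd' a1 b1 kt.
have h12 := defect_bound2_sparse hd a1 b2 ltac:(lia).
have h21 := defect_bound2_sparse hd a2 b1 ltac:(lia).
have h22 := defect_bound2_sparse hd' a2 b2 ltac:(lia).
have dab : defect a b = defect (restrict O a) (restrict P b)
   + defect (restrict O a) (restrict (~: P) b)
   + (defect (restrict (~: O) a) (restrict P b)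
   + defect (restrict (~: O) a) (restrict (~: P) b)).
  by rewrite {1}(restrict_split O a) {1}(restrict_split P b) defectDl !defectDr.
(* The diagonal terms contribute [d]; the four mixed pairs contribute [d + d'], as each piece meets
   [d] once and [d'] once. *)
have na := norm2_restrict_split O a; have nb := norm2_restrict_split P b.
rewrite dab na nb in ha hb *; lra.
Qed.

End Isometry.

(** * Error estimates for thresholding and for the heavy-ball step *)

Section Thresholding.
Variables (R : realType) (m n : nat) (A : 'M[R]_(m, n)).
Implicit Types (u v w e z : 'cV[R]_n).

Lemma sparse_restrict k (S : {set 'I_n}) u : (#|S| <= k)%N -> sparse k (restrict S u).
Proof.
by apply: leq_trans; rewrite supp_restrict subset_leq_card ?finset.subsetIl.
Qed.

Lemma rip_norm2_le k d u : rip_bound A k d -> sparse k u ->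
  norm2 (A *m u) <= Num.sqrt (1 + d) * norm2 u.
Proof.
move=> [d0 hd] su; have [_ h] := hd u su.
rewrite -(@ler_pXn2r _ 2) ?nnegrE ?mulr_ge0 ?sqrtr_ge0 ?norm2_ge0 //.
have d1 : 0 <= 1 + d by rewrite addr_ge0.
by rewrite exprMn (sqr_sqrtr d1).
Qed.

(** The columns of [A] in [S] and their transpose have the same operator norm: pair [g] with itself
    and move [A^T] across. *)
Lemma norm2_restrict_adjoint k d (S : {set 'I_n}) (v : 'cV[R]_m) :
  rip_bound A k d -> (#|S| <= k)%N ->
  norm2 (restrict S (A^T *m v)) <= Num.sqrt (1 + d) * norm2 v.
Proof.
move=> hd Sk; set g := restrict S _.
apply: norm2_le_dot; last by rewrite mulr_ge0 ?sqrtr_ge0 ?norm2_ge0.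
rewrite norm2_dotc {2}/g -dotc_restrict -dotc_mul.
apply: le_trans (dotc_le _ _) _; rewrite mulrAC ler_wpM2r ?norm2_ge0 //.
exact/(rip_norm2_le hd)/sparse_restrict.
Qed.

Lemma norm2_restrict_defect k t d (S : {set 'I_n}) e :
  rip_bound A t d -> (uphalf k + uphalf k <= t)%N -> (#|S| <= k)%N ->
  sparse k (restrict (~: S) e) ->
  norm2 (restrict S (e - A^T *m (A *m e))) <= Num.sqrt 5 * d * norm2 e.
Proof.
move=> hd kt Sk se; set g := restrict S _; have d0 := proj1 hd.
apply: norm2_le_dot; last by rewrite !mulr_ge0 ?sqrtr_ge0 ?norm2_ge0.
rewrite norm2_dotc {2}/g -dotc_restrict dotcBr -dotc_mul -/g -/(defect A g e).
rewrite {1}(restrict_split S e) defectDr.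
have sg : sparse k g by exact: sparse_restrict.
have h1 : defect A g (restrict S e) <= d * norm2 g * norm2 (restrict S e).
  apply: (defect_bound hd); apply: leq_trans (_ : #|S| <= _)%N; last by lia.
  by rewrite subset_leq_card // finset.subUset !supp_restrict !finset.subsetIl.
have h2 := defect_bound_cross hd kt sg se.
apply: le_trans (lerD h1 h2) _.
set p := norm2 (restrict S e); set q := norm2 (restrict (~: S) e).
have -> : d * norm2 g * p + 2 * d * norm2 g * q = (p + 2 * q) * (d * norm2 g).
  by ring.
have -> : Num.sqrt 5 * d * norm2 e * norm2 g
    = (Num.sqrt 5 * norm2 e) * (d * norm2 g) by ring.
rewrite ler_wpM2r ?mulr_ge0 ?norm2_ge0 //.
rewrite -(@ler_pXn2r _ 2) ?nnegrE ?addr_ge0 ?mulr_ge0 ?sqrtr_ge0 ?norm2_ge0 //.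
rewrite exprMn (sqr_sqrtr (ler0n R 5)) (norm2_restrict_split S) -/p -/q.
(* The constant [sqrt 5] is Cauchy-Schwarz for [(1, 2)] and [(p, q)]: the gap between
   [5 (p^2 + q^2)] and [(p + 2 q)^2] is this square. *)
have := sqr_ge0 (q - 2 * p); lra.
Qed.

Lemma binary_weights_card k w : binary_weights k w -> #|supp w| = k.
Proof.
case=> w01 sw; apply/eqP; rewrite -(eqr_nat R) -sw -sum1_card natr_sum big_mkcond.
apply/eqP; apply: eq_bigr => i _; rewrite inE.
by case: (w01 i) => ->; rewrite ?eqxx ?oner_eq0.
Qed.

Lemma sparse_hadamard k u w : binary_weights k w -> sparse k (hadamard u w).
Proof.
move=> /binary_weights_card <-; apply/subset_leq_card/fintype.subsetP => i.
by rewrite !inE mxE mulf_eq0 negb_or => /andP[].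
Qed.

Lemma binary_weights_indicator (S : {set 'I_n}) :
  binary_weights #|S| (\col_i (i \in S)%:R : 'cV[R]_n).
Proof.
split=> [i|]; first by rewrite mxE; case: (i \in S); [right|left].
rewrite -sum1_card natr_sum [RHS]big_mkcond; apply: eq_bigr => i _.
by rewrite mxE; case: (i \in S).
Qed.

Lemma hadamard_indicator (S : {set 'I_n}) u :
  hadamard u (\col_i (i \in S)%:R) = restrict S u.
Proof.
by apply/matrixP => i j; rewrite ord1 !mxE; case: (i \in S); rewrite ?mulr1 ?mulr0.
Qed.

(** The indicator of [S] is an admissible weight, so the residual at [x'] is at most that at
    [restrict S u]. Passing from [A *m (z - x')] to residuals and back pays for the noise twice.
    Only the residual of [x'] enters, which covers both algorithms. *)
Lemma optimal_weights_bound k t d d' (y eps : 'cV[R]_m) (S : {set 'I_n}) u w z x' :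
  rip_bound A k d -> rip_bound A t d' -> (uphalf k + uphalf k <= t)%N ->
  #|S| = k -> restrict S z = z -> y = A *m z + eps ->
  optimal_weights A y k u w -> sparse k x' ->
  norm2 (y - A *m x') ^+ 2 <= norm2 (y - A *m hadamard u w) ^+ 2 ->
  0 <= 1 - 2 * d - d' ->
  Num.sqrt (1 - 2 * d - d') * norm2 (z - x') <=
    Num.sqrt (1 + d) * norm2 (restrict S (z - u)) + 2 * norm2 eps.
Proof.
move=> hd hd' kt Sk zS yE [_ wmin] sx' x'min dd'.
have szx : sparse (k + k) (z - x').
  have sz : sparse k z by rewrite -zS; apply: sparse_restrict; rewrite Sk.
  have sNx' : sparse k (- x').
    by rewrite -scaleN1r; apply: leq_trans (subset_leq_card (suppZ _ _)) sx'.
  apply: leq_trans (subset_leq_card (suppD z (- x'))) _.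
  by apply: leq_trans (leq_add sz sNx'); rewrite finset.cardsU leq_subr.
have hlow : Num.sqrt (1 - 2 * d - d') * norm2 (z - x') <= norm2 (A *m (z - x')).
  rewrite -(@ler_pXn2r _ 2) ?nnegrE ?mulr_ge0 ?sqrtr_ge0 ?norm2_ge0 //.
  rewrite exprMn (sqr_sqrtr dd').
  have := defect_bound_double kt hd hd' szx.
  by rewrite /defect -!norm2_dotc; lra.
have hup : norm2 (A *m restrict S (z - u))
    <= Num.sqrt (1 + d) * norm2 (restrict S (z - u)).
  by apply: rip_norm2_le hd _; apply: sparse_restrict; rewrite Sk.
have hmin : norm2 (y - A *m x') <= norm2 (y - A *m restrict S u).
  rewrite -(@ler_pXn2r _ 2) ?nnegrE ?norm2_ge0 //; apply: le_trans x'min _.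
  rewrite -hadamard_indicator; apply: wmin; rewrite -Sk.
  exact: binary_weights_indicator.
have h1 : norm2 (A *m (z - x')) <= norm2 (y - A *m x') + norm2 eps.
  have -> : A *m (z - x') = (y - A *m x') + (-1) *: eps.
    by rewrite yE mulmxBr scaleN1r addrAC addrK.
  by apply: le_trans (norm2D _ _) _; rewrite norm2Z normrN1 mul1r.
have h2 : norm2 (y - A *m restrict S u) <= norm2 (A *m restrict S (z - u)) + norm2 eps.
  have -> : y - A *m restrict S u = A *m restrict S (z - u) + eps.
    by rewrite restrictB zS mulmxBr yE addrAC.
  exact: norm2D.
lra.
Qed.

Lemma hb_point_bound k t d d' (y eps : 'cV[R]_m) (S : {set 'I_n}) alpha beta x0 x1 z :
  rip_bound A k d -> rip_bound A t d' -> (uphalf k + uphalf k <= t)%N ->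
  #|S| = k -> restrict S z = z -> y = A *m z + eps -> sparse k x1 ->
  0 <= alpha -> 0 <= beta ->
  norm2 (restrict S (z - hb_point A y alpha beta x0 x1)) <=
    (`|1 + beta - alpha| + Num.sqrt 5 * alpha * d') * norm2 (z - x1)
    + beta * norm2 (z - x0) + alpha * Num.sqrt (1 + d) * norm2 eps.
Proof.
move=> hd hd' kt Sk zS yE sx1 a0 b0.
set e1 := z - x1; set e0 := z - x0.
(* Splitting off [1 + beta - alpha] leaves [I - A^T A] acting on [e1]; the momentum term uses
   [x1 - x0 = e0 - e1]. *)
have -> : z - hb_point A y alpha beta x0 x1 =
    (1 + beta - alpha) *: e1 + (alpha *: (e1 - A^T *m (A *m e1))
    + ((- beta) *: e0 + (- alpha) *: (A^T *m eps))).
  have -> : A *m e1 = y - eps - A *m x1 by rewrite yE addrK mulmxBr.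
  rewrite /hb_point (_ : A *m x1 - y = - (y - eps - A *m x1) - eps); last first.
    set v := A *m x1; by apply/matrixP => i j; rewrite !mxE; ring.
  set r := y - eps - _; rewrite mulmxBr mulmxN.
  set p := A^T *m r; set q := A^T *m eps.
  by apply/matrixP => i j; rewrite !mxE; ring.
rewrite !restrictD !restrictZ.
have hT1 := norm2D ((1 + beta - alpha) *: restrict S e1)
  (alpha *: restrict S (e1 - A^T *m (A *m e1))
    + ((- beta) *: restrict S e0 + (- alpha) *: restrict S (A^T *m eps))).
have hT2 := norm2D (alpha *: restrict S (e1 - A^T *m (A *m e1)))
    ((- beta) *: restrict S e0 + (- alpha) *: restrict S (A^T *m eps)).
have hT3 := norm2D ((- beta) *: restrict S e0) ((- alpha) *: restrict S (A^T *m eps)).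
rewrite !norm2Z !normrN (ger0_norm a0) (ger0_norm b0) in hT1 hT2 hT3.
have k1 : `|1 + beta - alpha| * norm2 (restrict S e1)
    <= `|1 + beta - alpha| * norm2 e1 by rewrite ler_wpM2l ?norm2_restrict_le.
have k2 : alpha * norm2 (restrict S (e1 - A^T *m (A *m e1)))
    <= alpha * (Num.sqrt 5 * d' * norm2 e1).
  rewrite ler_wpM2l //; apply: norm2_restrict_defect hd' kt _ _; rewrite ?Sk //.
  (* Off [S] the vector [z] vanishes, so the error there is [- x1] restricted, hence [k]-sparse. *)
  rewrite /e1 -zS restrictB -scaleN1r.
  rewrite (_ : restrict (~: S) (restrict S z) = 0) ?add0r.
    apply: leq_trans (subset_leq_card (suppZ _ _)) (leq_trans _ sx1).
    by rewrite subset_leq_card // supp_restrict finset.subsetIr.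
  by apply/matrixP => i j; rewrite !mxE finset.in_setC; case: (i \in S).
have k3 : beta * norm2 (restrict S e0) <= beta * norm2 e0.
  by rewrite ler_wpM2l ?norm2_restrict_le.
have k4 : alpha * norm2 (restrict S (A^T *m eps))
    <= alpha * (Num.sqrt (1 + d) * norm2 eps).
  by rewrite ler_wpM2l //; apply: norm2_restrict_adjoint hd _; rewrite Sk.
lra.
Qed.

End Thresholding.

(** * Scalar recurrences and the characteristic root *)

(* The combination [e p.+1 + (theta - b) * e p] contracts by the factor theta. *)
Lemma two_step_recurrence (R : realFieldType) (e : nat -> R) (b c D theta : R) :
  (forall p, 0 <= e p) -> 0 <= D -> 0 <= theta < 1 -> b <= theta ->
  theta ^+ 2 = b * theta + c ->
  (forall p, (1 <= p)%N -> e p.+1 <= b * e p + c * e p.-1 + D) ->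
  forall p, (1 <= p)%N ->
    e p <= (e 1%N + (theta - b) * e 0%N) * theta ^+ p.-1 + D / (1 - theta).
Proof.
move=> e0 D0 /andP[th0 th1] bth thE he.
set C := _ + _ * e 0%N; set K := D / _.
have th1' : 0 < 1 - theta by rewrite subr_gt0.
(* [K] is the fixed point of multiplying by [theta] and adding [D], so the noise term reproduces
   itself in the induction. *)
have DE : D = (1 - theta) * K by rewrite /K mulrC divfK // gt_eqF.
have K0 : 0 <= K by rewrite divr_ge0 // ltW.
have h p : e p.+1 + (theta - b) * e p <= C * theta ^+ p + K.
  elim: p => [|p IH]; first by rewrite expr0 mulr1 lerDl.
  have := he p.+1 isT; have := ler_wpM2l th0 IH; rewrite /= exprS.
  have -> : c = theta ^+ 2 - b * theta by rewrite thE; ring.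
  by rewrite [X in _ -> _ <= _ + _ + X -> _]DE; lra.
case=> // p _; apply: le_trans (h p).
by rewrite lerDl mulr_ge0 // subr_ge0.
Qed.

(** The root is below 1 when the square root is below [2 - b]; squaring makes this exactly
    [b + c < 1]. *)
Lemma positive_root_quadratic (R : rcfType) (b c : R) :
  let theta := (b + Num.sqrt (b ^+ 2 + 4 * c)) / 2 in
  0 <= b -> 0 <= c -> b + c < 1 ->
  [/\ theta ^+ 2 = b * theta + c, b <= theta & theta < 1].
Proof.
move=> theta b0 c0 bc; rewrite /theta {theta}.
have D0 : 0 <= b ^+ 2 + 4 * c by rewrite addr_ge0 ?sqr_ge0 ?mulr_ge0.
have sq := sqr_sqrtr D0; have s0 := sqrtr_ge0 (b ^+ 2 + 4 * c).
set s := Num.sqrt _ in sq s0 *.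
have bs : b <= s.
  by rewrite -(@ler_pXn2r _ 2) ?nnegrE // sq lerDl mulr_ge0.
have s2 : s < 2 - b.
  rewrite -(@ltr_pXn2r _ 2) ?nnegrE //; last by lra.
  by rewrite sq; lra.
split; [|lra|lra].
have -> : c = (s ^+ 2 - b ^+ 2) / 4 by rewrite sq; field.
by field.
Qed.

(** * Parameter conditions, one iteration, and the final constants *)

Theorem theorem1 (R : realType) (m n k : nat)
    (m_gt0 : (0 < m)%N) (m_lt_n : (m < n)%N)
    (k_gt0 : (1 <= k)%N) (k_lt_n : (k < n)%N)
    (A : 'M[R]_(m, n)) (x : 'cV[R]_n) (y nu : 'cV[R]_m)
    (y_def : y = A *m x + nu)
    (gamma : R) (gamma_gt0 : 0 < gamma) (gamma_lt1 : gamma < 1)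
    (gamma_root : 5 * gamma ^+ 3 + 5 * gamma ^+ 2 + 3 * gamma - 1 = 0)
    (S : {set 'I_n}) (S_def : largest k x S)
    (alpha beta : R) :
  let s : nat := if odd k then 1%N else 0%N in
  let dk := ric A k in
  let dks := ric A (k + s) in
  let eta := Num.sqrt ((1 + dk) / (1 - 2 * dk - dks)) in
  let nu' := nu + A *m restrict (~: S) x in
  let b := eta * (`|1 + beta - alpha| + Num.sqrt 5 * alpha * dks) in
  let theta := (b + Num.sqrt (b ^+ 2 + 4 * eta * beta)) / 2 in
  let C2 := (2 + (1 + dk) * alpha)
            / ((1 - theta) * Num.sqrt (1 - 2 * dk - dks)) in
  dks < gamma ->
  0 < alpha ->
  0 <= beta ->
  beta < (1 + 1 / eta) / (1 + Num.sqrt 5 * dks) - 1 ->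
  (1 + 2 * beta - 1 / eta) / (1 - Num.sqrt 5 * dks) < alpha ->
  alpha < (1 + 1 / eta) / (1 + Num.sqrt 5 * dks) ->
  theta < 1 /\
  forall X : nat -> 'cV[R]_n,
    sparse k (X 0%N) -> sparse k (X 1%N) ->
    HBOT A y k alpha beta X \/ HBOTP A y k alpha beta X ->
    let C1 := norm2 (restrict S x - X 1%N)
              + (theta - b) * norm2 (restrict S x - X 0%N) in
    forall p : nat, (1 <= p)%N ->
      norm2 (restrict S x - X p) <= C1 * theta ^+ p.-1 + C2 * norm2 nu'.
Proof.
move=> s dk dks eta nu' b theta C2 dks_lt alpha_gt0 beta_ge0 _ alpha_lb alpha_ub.
have hk : rip_bound A k dk := ricP A k.
have hks : rip_bound A (k + s) dks := ricP A (k + s).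
(* Twice the larger half of [k] is [k] plus its parity; this is the reason for [s]. The [change]
   shows the parity to [lia]. *)
have halves : (uphalf k + uphalf k <= k + s)%N.
  by change (uphalf k + uphalf k <= k + odd k)%N; lia.
have dk0 : 0 <= dk := proj1 hk.
have dks0 : 0 <= dks := proj1 hks.
have dk_le : dk <= dks by apply: ric_le; apply: rip_bound_mono hks; rewrite leq_addr.
(* In the cubic the two leading terms are positive. With [dk <= dks < gamma] this makes
   [1 - 2 * dk - dks] positive. *)
have gamma_lt : 3 * gamma < 1.
  have g3 : 0 < 5 * gamma ^+ 3 by rewrite mulr_gt0 ?exprn_gt0.
  have g2 : 0 < 5 * gamma ^+ 2 by rewrite mulr_gt0 ?exprn_gt0.
  lra.
have low_gt0 : 0 < 1 - 2 * dk - dks by lra.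
have up_ge0 : 0 <= 1 + dk by lra.
have up_gt0 : 0 < 1 + dk by lra.
have r_gt0 : 0 < Num.sqrt (1 - 2 * dk - dks) by rewrite sqrtr_gt0.
have etaE : eta = Num.sqrt (1 + dk) / Num.sqrt (1 - 2 * dk - dks).
  by rewrite /eta sqrtrM // sqrtrV // ltW.
have eta_gt0 : 0 < eta by rewrite etaE divr_gt0 // sqrtr_gt0.
have s5_ge0 : 0 <= Num.sqrt 5 :> R := sqrtr_ge0 5.
have s5_lt : Num.sqrt 5 < 3 :> R.
  rewrite -(@ltr_pXn2r _ 2) ?nnegrE // (sqr_sqrtr (ler0n R 5)); lra.
have s5d_ge0 : 0 <= Num.sqrt 5 * dks by rewrite mulr_ge0.
have s5d_lt1 : Num.sqrt 5 * dks < 1.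
  apply: le_lt_trans (_ : 3 * dks < 1); last by lra.
  by rewrite ler_wpM2r // ltW.
rewrite ltr_pdivrMr ?subr_gt0 // in alpha_lb.
rewrite ltr_pdivlMr ?(ltr_wpDr s5d_ge0 ltr01) // in alpha_ub.
(* When [1 + beta - alpha] is nonnegative this is the lower bound on [alpha]; otherwise [beta]
   cancels and it is the upper bound. *)
have contraction : `|1 + beta - alpha| + Num.sqrt 5 * alpha * dks + beta < 1 / eta.
  by case: ger0P => _; lra.
have b_ge0 : 0 <= b.
  by rewrite mulr_ge0 ?(ltW eta_gt0) // addr_ge0 // !mulr_ge0 // ltW.
have c_ge0 : 0 <= eta * beta by rewrite mulr_ge0 // ltW.
have bc_lt1 : b + eta * beta < 1.
  by rewrite /b -mulrDr mulrC -ltr_pdivlMr.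
have [thetaE b_le theta_lt1] : [/\ theta ^+ 2 = b * theta + eta * beta,
    b <= theta & theta < 1].
  by rewrite /theta -(mulrA 4); apply: positive_root_quadratic.
split=> // X sX0 sX1 hX C1.
set z := restrict S x.
have Sk : #|S| = k := proj1 S_def.
have zS : restrict S z = z.
  by apply/matrixP => i j; rewrite !mxE; case: (i \in S).
(* The part of [x] off [S] is absorbed into the noise. *)
have yE : y = A *m z + nu'.
  by rewrite y_def {1}(restrict_split S x) mulmxDr /nu' -addrA [nu + _]addrC.
(* What the two algorithms share. For HBOTP, the thresholded point is itself feasible in the
   least-squares step, so the residual can only drop. *)
have step p : (1 <= p)%N ->
    let u := hb_point A y alpha beta (X p.-1) (X p) in
    exists w, [/\ optimal_weights A y k u w, sparse k (X p.+1) &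
      norm2 (y - A *m X p.+1) ^+ 2 <= norm2 (y - A *m hadamard u w) ^+ 2].
  move=> p1 u; case: hX => /(_ p p1)[w [hw hXp]]; exists w; split => //.
  - by rewrite hXp; apply: sparse_hadamard; case: hw.
  - by rewrite hXp.
  - case: hXp => /= hs _; apply: leq_trans (subset_leq_card hs) _.
    by apply: sparse_hadamard; case: hw.
  - by case: hXp => _; apply => /=.
have sX p : sparse k (X p).
  by case: p => [//|[//|p]]; have [w []] := step p.+1 isT.
pose D := (2 + (1 + dk) * alpha) / Num.sqrt (1 - 2 * dk - dks) * norm2 nu'.
have C2E : C2 * norm2 nu' = D / (1 - theta).
  by rewrite /C2 /D invfM !mulrA [RHS]mulrAC; congr (_ * _); rewrite mulrAC.
have theta_ge0 : 0 <= theta by apply: le_trans b_le.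
rewrite C2E; apply: (two_step_recurrence (e := fun p => norm2 (z - X p))
  (c := eta * beta)) => //.
- by move=> p; exact: norm2_ge0.
- by rewrite /D !mulr_ge0 ?invr_ge0 ?norm2_ge0 ?addr_ge0 ?mulr_ge0 // ltW.
- by rewrite theta_ge0.
move=> p p1; have [w [hw sX' hmin]] := step p p1.
have h1 := optimal_weights_bound hk hks halves Sk zS yE hw sX' hmin (ltW low_gt0).
have h2 := hb_point_bound (X p.-1) hk hks halves Sk zS yE (sX p)
  (ltW alpha_gt0) beta_ge0.
set u := hb_point _ _ _ _ _ _ in h1 h2.
have h3 := le_trans h1 (lerD (ler_wpM2l (sqrtr_ge0 (1 + dk)) h2) (lexx _)).
rewrite mulrC -ler_pdivlMr // in h3; apply: le_trans h3 _.
(* One factor [sqrt (1 + dk)] comes from [A], one from its adjoint. Written as a square, the two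
   sides agree by [field]. *)
have -> : D = (2 + Num.sqrt (1 + dk) ^+ 2 * alpha)
    / Num.sqrt (1 - 2 * dk - dks) * norm2 nu' by rewrite (sqr_sqrtr up_ge0).
rewrite /b etaE le_eqVlt; apply/orP; left; apply/eqP.
by field; rewrite gt_eqF.
Qed.
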